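(* Let $\mathbb K$ be an algebraically closed field of characteristic zero, let $f \in \mathbb K[x,y]$ be a nonconstant polynomial and $D_f$ the corresponding Jacobian derivation. Let $p$ be a generative closed polynomial for $f$. Then the centralizer $C_{W_2(\mathbb K)}(D_f)$ is a free module of rank $1$ or $2$ over the subring $\mathbb K[p]$ of $\mathbb K[x,y]$.
   Context: $W_2(\mathbb K)$ is the Lie algebra of all $\mathbb K$-derivations of $\mathbb K[x,y]$ with bracket $[D_1,D_2] = D_1D_2 - D_2D_1$; it is a $\mathbb K[x,y]$-module via $(gD)(h) = g\cdot D(h)$. For $f \in \mathbb K[x,y]$ the Jacobian derivation $D_f \in W_2(\mathbb K)$ is defined by $D_f(h) = \det J(f,h) = f'_x h'_y - f'_y h'_x$ for all $h\in\mathbb K[x,y]$. The centralizer is $C_{W_2(\mathbb K)}(D_f) = \{T \in W_2(\mathbb K) : [T, D_f] = 0\}$, regarded as a $\mathbb K[p]$-module by restricting the $\mathbb K[x,y]$-module structure of $W_2(\mathbb K)$. A polynomial $p \in \mathbb K[x,y]$ is called closed if the subalgebra $\mathbb K[p]$ is integrally closed in $\mathbb K[x,y]$. A generative closed polynomial for $f$ is a closed polynomial $p$ such that $f = \varphi(p)$ for some $\varphi(t) \in \mathbb K[t]$. *)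

(* Defs.v *)
(* K[x, y] is {mpoly K[2]}, with x = 'X_0 and y = 'X_1. *)
From mathcomp Require Import all_boot all_order all_algebra.
From mathcomp Require Import mpoly ring.
From mathcomp Require Import classical_sets functions.

Set Implicit Arguments.
Unset Strict Implicit.
Unset Printing Implicit Defensive.

Import GRing.Theory.

Local Open Scope ring_scope.
Local Open Scope classical_set_scope.

Section FreeModules.
Variables (A : comNzRingType) (V : lmodType A).

(* S is meant to be a subring of A; V is seen as an S-module by restriction. *)
Definition is_submodule (S : set A) (M : set V) : Prop :=
  M 0 /\ forall a u v, S a -> M u -> M v -> M (a *: u + v).

Definition is_basis (S : set A) (M : set V) (r : nat) (b : 'I_r -> V) : Prop :=
  (forall i, M (b i)) /\
  forall v, M v ->
    exists! c : {ffun 'I_r -> A}, (forall i, S (c i)) /\ v = \sum_i c i *: b i.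

Definition free_module_of_rank (S : set A) (M : set V) (r : nat) : Prop :=
  is_submodule S M /\ exists b : 'I_r -> V, is_basis S M b.

End FreeModules.

Section PlaneDerivations.
Variable K : fieldType.
Local Notation A := {mpoly K[2]}.

Definition W2 : set (A -> A) :=
  [set D | linear D /\ forall g h : A, D (g * h) = D g * h + g * D h].

Definition lie_bracket (D1 D2 : A -> A) : A -> A :=
  fun h => D1 (D2 h) - D2 (D1 h).

Definition jacobian_der (f : A) : A -> A :=
  fun h => f^`M(0) * h^`M(1) - f^`M(1) * h^`M(0).

Lemma jacobian_der_W2 f : W2 (jacobian_der f).
Proof.
split=> [c g h | g h]; rewrite /jacobian_der.
  by rewrite !mderivD !mderivZ -!mul_mpolyC; ring.
by rewrite !mderivM; ring.
Qed.

Definition centralizer (D : A -> A) : set (A -> A) :=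
  [set T | W2 T /\ lie_bracket T D = 0].

Definition subalg_gen (p : A) : set A := range (@horner_alg K A p).

Definition closed_poly (p : A) : Prop :=
  forall z : A, integralOver (@horner_alg K A p) z -> subalg_gen p z.

Definition generative_closed (f p : A) : Prop :=
  closed_poly p /\ exists phi : {poly K}, f = horner_alg p phi.

End PlaneDerivations.

(* Functions into the regular module A^o form an A-module under pointwise
   scaling, (g *: D) h = g * D h: this is the K[x, y]-module structure of W2. *)
Notation vfield K := ({mpoly K[2]} -> {mpoly K[2]}^o).

(* Main.v *)
Require Import Defs.
From mathcomp Require Import all_boot all_order all_algebra.
From mathcomp Require Import mpoly.
From mathcomp Require Import classical_sets functions.
From mathcomp Require Import ring zify boolp.
Import GRing.Theory Order.TTheory.
Local Open Scope ring_scope.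
Set Implicit Arguments.
Unset Strict Implicit.
Unset Printing Implicit Defensive.

(** Write D_g for the Jacobian derivation of g and f = phi(p). Then
    D_f = phi'(p) D_p, and phi'(p) is nonzero because f is not constant.

    The kernel of D_p on K[x, y] is K[p] ([jacobian_ker_closed]). If two
    polynomials g and h have vanishing Jacobian, the exponents of their leading
    monomials are parallel, since the coefficient of the Jacobian at the expected
    leading monomial is a nonzero multiple of the determinant of these two
    exponents. So all the leading monomials of ker D_p lie on the ray through
    that of p, and such a monomial is determined by its degree. Choosing in
    ker D_p an element of least degree in each residue class modulo deg p, and
    cancelling leading terms, one finds that ker D_p is a finitely generated
    K[p]-module; hence it is integral over K[p] ([integral_over_subalg]), hence
    equal to K[p] as p is closed.

    Now consider the K[p]-linear map T |-> T(p) on the centralizer C of D_f.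
    - Its values lie in K[p]: T and D_f commute, so D_f(T(f)) = T(D_f(f)) = 0,
      while T(f) = phi'(p) T(p), so T(p) is in ker D_p
      ([centralizer_value]).
    - Its kernel is K[p] D_p: if T is in C and T(p) = 0, then T(f) = 0 and the
      identity [T, D_f] = D_(T(f)) - div(T) D_f forces div(T) = 0. In
      characteristic 0 a divergence-free T is a Jacobian derivation D_k
      ([poincare]), and D_k(p) = 0 puts k in K[p], k = s(p), so that
      T = s'(p) D_p ([centralizer_annihilating]).

    The image is an ideal of the principal ideal ring K[p]. If it is zero, C is
    free on D_p; otherwise C is free on D_p and any T0 whose value T0(p)
    generates the image. *)

Lemma big_ord2 (R : Type) (idx : R) (op : Monoid.law idx) (F : 'I_2 -> R) :
  \big[op/idx]_(i < 2) F i = op (F 0) (F 1).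
Proof.
rewrite big_ord_recl big_ord1; congr (op (F _) (F _)); exact: val_inj.
Qed.

Lemma forall_ord2 (P : 'I_2 -> Prop) : P 0 -> P 1 -> forall i, P i.
Proof.
move=> P0 P1 [[|[|//]] lt_i].
  by rewrite (_ : Ordinal lt_i = 0) //; apply: val_inj.
by rewrite (_ : Ordinal lt_i = 1) //; apply: val_inj.
Qed.

(** * Euler operators and divergence-free fields in characteristic zero *)

Lemma mderivXX (R : comNzRingType) n (i j : 'I_n) :
  ('X_j : {mpoly R[n]})^`M(i) = (i == j)%:R.
Proof.
rewrite mderivX mnm1E eq_sym; case: eqVneq => [->|]; rewrite ?scale0r //.
by rewrite scale1r -[X in (X - _)%MM]add0m addmK mpolyX0.
Qed.

Section CharacteristicZero.
Variables (K : fieldType) (charK0 : [pchar K] =i pred0).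

Lemma natr_eq0 k : (k%:R == 0 :> K) = (k == 0)%N.
Proof. by move: k; apply/pcharf0P. Qed.

(** The operators 'X_i d/d'X_i are diagonal in the basis of monomials. This is
    what makes both leading coefficients and antiderivatives computable below
    without shifting exponents. *)
Lemma mcoeff_mulX_deriv n (i : 'I_n) (p : {mpoly K[n]}) m :
  ('X_i * p^`M(i))@_m = (m i)%:R * p@_m.
Proof.
elim/mpolyind: p => [|c m' p _ _ IH].
  by rewrite mderiv0 mulr0 mcoeff0 mulr0.
rewrite mderivD mulrDr mcoeffD IH mderivZ mderivX -!scalerAr !mcoeffZ mcoeffD.
rewrite mcoeffZ mulrDr; congr (_ + _).
case Hi: (m' i) => [|k].
  rewrite mul0r mulr0 mcoeffX; case: eqP => [<-|]; last by rewrite !mulr0.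
  by rewrite Hi mul0r.
rewrite -mpolyXD addmC submK; last by rewrite lep1mP Hi.
rewrite mcoeffX; case: eqP => [<-|]; last by rewrite !mulr0.
by rewrite Hi mulrCA.
Qed.

Lemma mcoeff0_mul_var n (i : 'I_n) (p : {mpoly K[n]}) : ('X_i * p)@_0 = 0.
Proof. by rewrite rmorphM /= mcoeffX mnm1_eq0 mul0r. Qed.

Lemma mderiv_eq0_const n (p : {mpoly K[n]}) :
  (forall i, p^`M(i) = 0) -> p = (p@_0)%:MP.
Proof.
move=> dp0; apply/mpolyP => m; rewrite mcoeffC.
case: eqVneq => [->|m_nz]; first by rewrite mulr1.
rewrite mulr0; have [i mi_nz] : exists i, m i != 0%N.
  apply/existsP; apply: contraNT m_nz; rewrite negb_exists => /forallP m0.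
  by apply/eqP/mnmP => i; rewrite mnm0E; apply/eqP; have := m0 i; rewrite negbK.
have := mcoeff_mulX_deriv i p m; rewrite dp0 mulr0 mcoeff0 => /esym/eqP.
by rewrite mulf_eq0 natr_eq0 (negPf mi_nz) => /eqP.
Qed.

Definition euler n (p : {mpoly K[n]}) := \sum_i 'X_i * p^`M(i).

Lemma mcoeff_euler n (p : {mpoly K[n]}) m :
  (euler p)@_m = (mdeg m)%:R * p@_m.
Proof.
rewrite /euler raddf_sum /= mdegE natr_sum mulr_suml.
by apply: eq_bigr => i _; rewrite mcoeff_mulX_deriv.
Qed.

(** In characteristic 0, degree 0 is the only zero eigenvalue, so the constant
    term is the only obstruction to inverting the Euler operator. *)
Lemma euler_surj n (p : {mpoly K[n]}) :
  exists q, euler q = p - (p@_0)%:MP.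
Proof.
elim/mpolyind: p => [|c m p _ _ [q Eq]].
  exists 0; apply/mpolyP => k.
  by rewrite mcoeff_euler !mcoeff0 mpolyC0 subr0 mcoeff0 mulr0.
exists (q + (c / (mdeg m)%:R) *: 'X_[m]); apply/mpolyP => k.
have := congr1 (mcoeff k) Eq.
rewrite !mcoeff_euler !mcoeffD !mcoeffN !mcoeffC !mcoeffZ !mcoeffX mulrDr => ->.
case: (eqVneq m k) => [<-|ne_mk].
  case: (eqVneq m 0%MM) => [->|m_nz]; first by rewrite mdeg0 /=; ring.
  have nz : (mdeg m)%:R != 0 :> K by rewrite natr_eq0 mdeg_eq0.
  by rewrite /=; field.
case: (eqVneq m 0%MM) => [m0|m_nz]; last by rewrite /=; ring.
by move: ne_mk; rewrite m0 eq_sym => /negPf -> /=; ring.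
Qed.

(** The eigenvalues of euler + id are the numbers deg + 1, all nonzero. *)
Lemma euler_addid_inj n (p : {mpoly K[n]}) : euler p + p = 0 -> p = 0.
Proof.
move=> E; apply/mpolyP => m; rewrite mcoeff0.
have /eqP := congr1 (mcoeff m) E.
rewrite mcoeffD mcoeff_euler mcoeff0 -[X in _ + X]mul1r -mulrDl natr1.
by rewrite mulf_eq0 natr_eq0 => /eqP.
Qed.

(** A divergence-free field a d/dx + b d/dy is Hamiltonian. The potential is the
    solution h of euler h = x b - y a, whose right-hand side has no constant
    term. Differentiating this equation, commuting the derivative past the Euler
    operator (each commutation costs one identity) and using div = 0 gives
    (euler + id) (dh/dx - b) = 0, and similarly for dh/dy + a. *)
Lemma poincare (a b : {mpoly K[2]}) : a^`M(0) + b^`M(1) = 0 ->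
  exists h : {mpoly K[2]}, a = - h^`M(1) /\ b = h^`M(0).
Proof.
move=> div0; have [h Eh] := euler_surj ('X_0 * b - 'X_1 * a).
have {Eh} : euler h = 'X_0 * b - 'X_1 * a.
  by rewrite Eh mcoeffB !mcoeff0_mul_var subr0 mpolyC0 subr0.
rewrite /euler big_ord2 => Eh; exists h.
split; apply/eqP.
  rewrite -subr_eq0 opprK; apply/eqP/euler_addid_inj.
  rewrite /euler big_ord2 !mderivD.
  have := congr1 (mderiv 1) Eh.
  rewrite !(mderivD, mderivN, mderivM, mderivXX) /=.
  have -> : b^`M(1) = - a^`M(0) by apply/eqP; rewrite -addr_eq0 addrC div0.
  rewrite (mderiv_comm 1 0) => E.
  by move/eqP: E; rewrite -subr_eq0 => /eqP <-; ring.
rewrite -subr_eq0; apply/eqP/euler_addid_inj.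
rewrite /euler big_ord2 !mderivB.
have := congr1 (mderiv 0) Eh; rewrite !(mderivD, mderivN, mderivM, mderivXX) /=.
have -> : a^`M(0) = - b^`M(1) by apply/eqP; rewrite -addr_eq0 div0.
rewrite (mderiv_comm 0 1) => E.
by move/eqP: E; rewrite eq_sym -subr_eq0 => /eqP <-; ring.
Qed.
End CharacteristicZero.

(** * Subalgebras whose leading monomials are determined by their degree *)

(** The determinant trick: z is an eigenvalue of the matrix M, with eigenvector a,
    so the domain hypothesis makes z a root of the characteristic polynomial of
    M, which is monic with coefficients in R. *)
Lemma integral_of_stable_span (R : comNzRingType) (L : idomainType)
    (RtoL : {rmorphism R -> L}) d (a : 'I_d -> L) (M : 'I_d -> 'I_d -> R) z :
  (exists i, a i != 0) ->
  (forall i, z * a i = \sum_j RtoL (M i j) * a j) -> integralOver RtoL z.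
Proof.
move=> [i0 ai0] za; pose A := \matrix_(i, j) M i j.
pose B := z%:M - map_mx RtoL A.
have Ba : B *m (\col_i a i) = 0.
  apply/eqP; rewrite mulmxBl mul_scalar_mx subr_eq0; apply/eqP/colP => i.
  by rewrite !mxE za; apply: eq_bigr => j _; rewrite !mxE.
have detB : \det B = 0.
  have /colP/(_ i0) : \adj B *m (B *m \col_i a i) = 0 by rewrite Ba mulmx0.
  rewrite mulmxA mul_adj_mx mul_scalar_mx !mxE => /eqP.
  by rewrite mulf_eq0 (negPf ai0) orbF => /eqP.
exists (char_poly A); first exact: char_poly_monic.
rewrite map_char_poly rootE -horner_evalE -det_map_mx -detB.
apply/eqP; congr (\det _); apply/matrixP => i j.
by rewrite !mxE /= horner_evalE hornerD hornerN hornerMn hornerX hornerC.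
Qed.

Lemma mdeg_mlead_gt0 (R : nzRingType) n (p : {mpoly R[n]}) :
  (forall c, p <> c%:MP) -> (0 < mdeg (mlead p))%N.
Proof.
move=> p_nc; have p_nz : p != 0.
  by apply/eqP => p0; apply: (p_nc 0); rewrite mpolyC0.
rewrite lt0n; apply: contra_not_neq (p_nc p@_0) => p0.
by apply: msize1_polyC; rewrite -mlead_deg // p0.
Qed.

Section LeadingMonomials.
Variables (K : fieldType) (n : nat).
Local Notation A := {mpoly K[n]}.
Variables (B : set A) (p : A).
Hypotheses (B_sub : forall g h, B g -> B h -> B (g - h))
  (B_mul : forall g h, B g -> B h -> B (g * h))
  (B_const : forall c, B c%:MP) (Bp : B p)
  (B_mlead : forall g h, B g -> B h -> g != 0 -> h != 0 ->
    mdeg (mlead g) = mdeg (mlead h) -> mlead g = mlead h).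
Local Notation d := (mdeg (mlead p)).
Hypothesis p_deg : (0 < d)%N.

Let p_nz : p != 0.
Proof. by apply: contraTneq p_deg => ->; rewrite mlead0 mdeg0. Qed.

Let B_exp k : B (p ^+ k).
Proof.
elim: k => [|k IH]; first by rewrite expr0 -mpolyC1; apply: B_const.
by rewrite exprS; apply: B_mul.
Qed.

(** The implication is vacuous for a class r in which B has no nonzero element;
    a = 0 is then taken, so that a single family indexed by all the residues
    covers both cases. *)
Lemma exists_min_degree_in_class (r : 'I_d) : exists a, B a /\
  forall h, B h -> h != 0 -> (mdeg (mlead h) %% d)%N = r ->
    [/\ a != 0, (mdeg (mlead a) %% d)%N = r
      & (mdeg (mlead a) <= mdeg (mlead h))%N].
Proof.
pose P m := `[< exists h, [/\ B h, h != 0, (mdeg (mlead h) %% d)%N = r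
                                & mdeg (mlead h) = m] >].
case: (pselect (exists m, P m)) => [exP | noP]; last first.
  exists 0; split; first by rewrite -mpolyC0.
  move=> h Bh h_nz hr; case: noP; exists (mdeg (mlead h)); apply/asboolP.
  by exists h.
case: (ex_minnP exP) => m /asboolP[a [Ba a_nz ar am]] min_m.
exists a; split=> // h Bh h_nz hr; split=> //; rewrite am; apply: min_m.
by apply/asboolP; exists h.
Qed.

(** With k chosen so that p ^+ k * a has the degree of h, these two elements of B
    have the same leading monomial, which can be cancelled. The difference is
    again in B, so if it still had the degree of h it would have the same leading
    monomial: the cancellation lowers the degree and not merely the monomial. *)
Lemma reduce_leading_term (a h : A) : B a -> a != 0 -> B h -> h != 0 ->
  mdeg (mlead a) = mdeg (mlead h) %[mod d] ->
  (mdeg (mlead a) <= mdeg (mlead h))%N ->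
  exists c k, B (h - (c%:MP * p ^+ k) * a) /\
    (msize (h - (c%:MP * p ^+ k) * a) < msize h)%N.
Proof.
move=> Ba a_nz Bh h_nz eq_mod le_ah.
pose k := ((mdeg (mlead h) - mdeg (mlead a)) %/ d)%N.
have kE : (d * k)%N = (mdeg (mlead h) - mdeg (mlead a))%N.
  by rewrite mulnC divnK // -eqn_mod_dvd // eq_mod.
pose q := p ^+ k * a.
have Bq : B q by apply: B_mul.
have q_nz : q != 0 by rewrite mulf_neq0 // expf_neq0.
have q_lead : mlead q = mlead h.
  apply: B_mlead => //; rewrite mleadM ?expf_neq0 // mleadX // mdegD mdegMn.
  by rewrite kE subnK.
pose c := mleadc h / mleadc q.
have qc_nz : mleadc q != 0 by rewrite mleadc_eq0.
have c_nz : c != 0 by rewrite mulf_neq0 ?invr_eq0 // mleadc_eq0.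
exists c, k; rewrite -mulrA -/q mul_mpolyC.
have Bh' : B (h - c *: q).
  by apply: B_sub => //; rewrite -mul_mpolyC; apply: B_mul.
split=> //; case: (eqVneq (h - c *: q) 0) => [->|h'_nz].
  by rewrite msize0 lt0n msize_poly_eq0.
rewrite -!mlead_deg // ltnS ltn_neqAle; apply/andP; split.
  apply/eqP => E; have {}E := B_mlead Bh' Bh h'_nz h_nz E.
  move: h'_nz; rewrite -mleadc_eq0 E mcoeffB mcoeffZ.
  by rewrite /c q_lead divfK ?subrr ?eqxx // -q_lead.
have := mleadB_le h (c *: q); rewrite mleadZ // q_lead joinxx.
exact: lemc_mdeg.
Qed.

(** Generators: one element of least degree in each residue class of degrees
    modulo deg p. They are not all zero since the class of 0 contains 1. *)
Lemma finite_over_subalg : exists a : 'I_d -> A,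
  [/\ forall i, B (a i), exists i, a i != 0 & forall h, B h ->
    exists c : 'I_d -> {poly K}, h = \sum_i horner_alg p (c i) * a i].
Proof.
have [a /all_and2[Ba min_a]] := fin_all_exists exists_min_degree_in_class.
exists a; split=> //.
  exists (Ordinal p_deg); case: (min_a (Ordinal p_deg) 1) => //.
  - by rewrite -mpolyC1; apply: B_const.
  - by rewrite oner_eq0.
  - by rewrite mlead1 mdeg0 mod0n.
move=> h; have [m] := ubnP (msize h); elim: m h => // m IH h lt_hm Bh.
have [->|h_nz] := eqVneq h 0.
  by exists (fun=> 0); rewrite big1 // => i _; rewrite rmorph0 mul0r.
pose r := Ordinal (ltn_pmod (mdeg (mlead h)) p_deg).
have [|||ar_nz ar le_ar] := min_a r h => //.
have [//|//|c [k [Bh' lt_h']]] := reduce_leading_term (Ba r) ar_nz Bh h_nz.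
have [|c' h'E] := IH _ _ Bh'; first exact: leq_trans lt_h' _.
exists (fun i => c' i + (i == r)%:R * (c%:P * 'X^k)).
rewrite (eq_bigr (fun i => horner_alg p (c' i) * a i +
  (i == r)%:R * (c%:MP * p ^+ k * a i))); last first.
  move=> i _; rewrite rmorphD mulrDl !rmorphM rmorph_nat rmorphXn /=.
  by rewrite horner_algC horner_algX -mul_mpolyC mulr1 !mulrA.
rewrite big_split /= -h'E (bigD1 r) //= eqxx mul1r big1 ?addr0 ?subrK //.
by move=> i /negPf ->; rewrite mul0r.
Qed.

(** Multiplication by z preserves the finitely generated K[p]-module B. *)
Lemma integral_over_subalg z : B z -> integralOver (@horner_alg K A p) z.
Proof.
move=> Bz; have [a [Ba a_nz spanB]] := finite_over_subalg.
have [M zM] := fin_all_exists (fun i => spanB _ (B_mul Bz (Ba i))).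
exact: (integral_of_stable_span a_nz zM).
Qed.
End LeadingMonomials.

(** * The kernel of a Jacobian derivation *)

Section JacobianKernel.
Variables (K : fieldType) (charK0 : [pchar K] =i pred0).
Local Notation A := {mpoly K[2]}.

Lemma mlead_mulX_deriv n (i : 'I_n) (p : {mpoly K[n]}) :
  (mlead ('X_i * p^`M(i)) <= mlead p)%O.
Proof.
have [->|] := eqVneq ('X_i * p^`M(i)) 0; first by rewrite mlead0 le0x.
move=> /mlead_supp; rewrite mcoeff_msupp mcoeff_mulX_deriv mulf_eq0 negb_or.
by case/andP=> _; rewrite -mcoeff_msupp => /msupp_le_mlead.
Qed.

(** Multiplied by x y, the Jacobian becomes an expression in the diagonal
    operators x d/dx and y d/dy. Its coefficient at the product of the leading
    monomials is the product of the leading coefficients times the determinant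
    of the two exponents, an integer, which must vanish in characteristic 0. *)
Lemma jacobian_mlead (g h : A) : g != 0 -> h != 0 -> jacobian_der g h = 0 ->
  (mlead g 0%R * mlead h 1%R = mlead g 1%R * mlead h 0%R)%N.
Proof.
rewrite /jacobian_der => g_nz h_nz J0.
have : ('X_0 * g^`M(0)) * ('X_1 * h^`M(1))
     - ('X_1 * g^`M(1)) * ('X_0 * h^`M(0)) = 0.
  by rewrite -[RHS](mulr0 ('X_0 * 'X_1)) -J0; ring.
move/(congr1 (mcoeff (mlead g + mlead h)%MM)).
rewrite mcoeffB !mleadcMW ?mlead_mulX_deriv // !mcoeff_mulX_deriv mcoeff0.
rewrite mulrACA [X in _ - X]mulrACA -mulrBl => /eqP.
rewrite mulf_eq0 [mleadc g * _ == 0]mulf_eq0 !mleadc_eq0.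
rewrite (negPf g_nz) (negPf h_nz) !orbF -!natrM => /eqP E.
case: (leqP (mlead g 0%R * mlead h 1%R) (mlead g 1%R * mlead h 0%R))%N => le_gh.
  move/eqP: E; rewrite -opprB oppr_eq0 -natrB // natr_eq0 // subn_eq0.
  by move=> ?; apply/eqP; rewrite eqn_leq le_gh.
move/eqP: E; rewrite -natrB 1?ltnW // natr_eq0 // subn_eq0.
by rewrite leqNgt le_gh.
Qed.

(** Both leading exponents lie on the ray through the nonzero leading exponent
    of p, and the degree fixes the position on that ray. *)
Lemma jacobian_ker_mlead (p g h : A) : (forall c, p <> c%:MP) ->
  g != 0 -> h != 0 -> jacobian_der p g = 0 -> jacobian_der p h = 0 ->
  mdeg (mlead g) = mdeg (mlead h) -> mlead g = mlead h.
Proof.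
move=> p_nc g_nz h_nz Jg Jh.
have p_nz : p != 0 by apply/eqP => p0; apply: (p_nc 0); rewrite mpolyC0.
have := mdeg_mlead_gt0 p_nc.
move: (jacobian_mlead p_nz g_nz Jg).
move: (jacobian_mlead p_nz h_nz Jh).
rewrite !mdegE !big_ord2 /= => Eh Eg p_deg E.
have {}E : mlead g 0 = mlead h 0 /\ mlead g 1 = mlead h 1 by nia.
by case: E => E0 E1; apply/mnmP; apply: forall_ord2.
Qed.

(** The kernel of D_p is a subalgebra to which [integral_over_subalg] applies, so
    its elements are integral over K[p]. *)
Lemma jacobian_ker_closed (p z : A) : closed_poly p ->
  (forall c, p <> c%:MP) -> jacobian_der p z = 0 -> subalg_gen p z.
Proof.
move=> p_closed p_nc Jz; apply: p_closed.
apply: (integral_over_subalg (B := fun h => jacobian_der p h = 0)) => //.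
- move=> g h Jg Jh; rewrite -[RHS]subr0 -{1}Jg -Jh.
  by rewrite /jacobian_der !mderivB; ring.
- move=> g h Jg Jh; transitivity (jacobian_der p g * h + g * jacobian_der p h).
    by rewrite /jacobian_der !mderivM; ring.
  by rewrite Jg Jh mul0r mulr0 addr0.
- by move=> c; rewrite /jacobian_der !mderivC; ring.
- by rewrite /jacobian_der; ring.
- by move=> g h Jg Jh g_nz h_nz; apply: jacobian_ker_mlead.
exact: mdeg_mlead_gt0.
Qed.
End JacobianKernel.

(** * Derivations of K[x, y] *)

Section Derivations.
Variable K : fieldType.
Local Notation A := {mpoly K[2]}.
Implicit Types (T : A -> A) (g h p : A).

Lemma W2_lin T c g h : W2 T -> T (c *: g + h) = c *: T g + T h.
Proof. by case=> linT _; apply: linT. Qed.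

Lemma W2_add T g h : W2 T -> T (g + h) = T g + T h.
Proof. by move=> W; rewrite -[g]scale1r W2_lin // !scale1r. Qed.

Lemma W2_0 T : W2 T -> T 0 = 0.
Proof. by move=> W; apply/(@addrI _ (T 0)); rewrite -W2_add // !addr0. Qed.

Lemma W2_opp T g : W2 T -> T (- g) = - T g.
Proof.
by move=> W; rewrite -[- g]addr0 -scaleN1r W2_lin // W2_0 // addr0 scaleN1r.
Qed.

Lemma W2_1 T : W2 T -> T 1 = 0.
Proof.
case=> _ M; have := M 1 1; rewrite !mulr1 mul1r => E.
by apply/(@addrI _ (T 1)); rewrite addr0 -E.
Qed.

Lemma W2_expand T h : W2 T -> T h = T 'X_0 * h^`M(0) + T 'X_1 * h^`M(1).
Proof.
move=> W; pose P h := T h = T 'X_0 * h^`M(0) + T 'X_1 * h^`M(1).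
have P1 : P 1 by rewrite /P W2_1 // -mpolyC1 !mderivC !mulr0 addr0.
have PM g k : P g -> P k -> P (g * k).
  by rewrite /P => Pg Pk; rewrite (proj2 W) Pg Pk !mderivM; ring.
have PX i : P 'X_i.
  move: i; apply: forall_ord2; rewrite /P !mderivXX /=; ring.
rewrite -/(P h); elim/mpolyind: h => [|c m h _ _ Ph].
  by rewrite /P W2_0 // !mderiv0 !mulr0 addr0.
have PXm : P 'X_[m].
  rewrite mpolyXE_id; apply: (big_ind P) => // i _.
  by elim: (m i) => [|k IH]; rewrite ?expr0 // exprS; apply: PM.
by rewrite /P W2_lin // PXm Ph !mderivD !mderivZ -!mul_mpolyC; ring.
Qed.

Lemma mderiv_horner_alg n (i : 'I_n) (p : {mpoly K[n]}) (s : {poly K}) :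
  (horner_alg p s)^`M(i) = horner_alg p s^`() * p^`M(i).
Proof.
elim/poly_ind: s => [|s c IH]; first by rewrite deriv0 !rmorph0 mderiv0 mul0r.
rewrite !rmorphD !rmorphM /= horner_algX horner_algC mderivD mderivM IH.
rewrite derivD derivC derivM derivX mulr1 addr0 !rmorphD !rmorphM /=.
by rewrite horner_algX -mul_mpolyC mulr1 mderivC; ring.
Qed.

Lemma W2_horner_alg T p s : W2 T ->
  T (horner_alg p s) = horner_alg p s^`() * T p.
Proof.
by move=> W; rewrite W2_expand // [T p]W2_expand // !mderiv_horner_alg; ring.
Qed.

Lemma jacobian_horner_alg p s h :
  jacobian_der (horner_alg p s) h = horner_alg p s^`() * jacobian_der p h.
Proof. by rewrite /jacobian_der !mderiv_horner_alg; ring. Qed.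

Lemma jacobian_self p : jacobian_der p p = 0.
Proof. by rewrite /jacobian_der; ring. Qed.

End Derivations.

(** * The centralizer of a Jacobian derivation *)

Section Centralizer.
Variables (K : fieldType) (charK0 : [pchar K] =i pred0).
Local Notation A := {mpoly K[2]}.

Lemma centralizerE (T : A -> A) f h : centralizer (jacobian_der f) T ->
  T (jacobian_der f h) = jacobian_der f (T h).
Proof.
by case=> _ /(congr1 (@^~ h)) E; apply/eqP; rewrite -subr_eq0; apply/eqP.
Qed.

(** If T(f) = 0 then [T, D_f] = - div(T) D_f. The hypotheses are used through
    the values of [T, D_f] at x and y and the two partial derivatives of the
    equation T(f) = 0, which combine to div(T) df/dy = div(T) df/dx = 0. *)
Lemma divergence_free (T : A -> A) f : (forall c, f <> c%:MP) ->
  centralizer (jacobian_der f) T -> T f = 0 ->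
  (T 'X_0)^`M(0) + (T 'X_1)^`M(1) = 0.
Proof.
move=> f_nc CT; have W := proj1 CT; rewrite (W2_expand f W) => Tf0.
have e0 := congr1 (mderiv 0) Tf0; have e1 := congr1 (mderiv 1) Tf0.
have := centralizerE 'X_1 CT; have := centralizerE 'X_0 CT.
move: e0 e1; rewrite /jacobian_der !mderivXX /= !mulr0 !mulr1 sub0r subr0.
rewrite (W2_opp _ W) (W2_expand f^`M(0) W) (W2_expand f^`M(1) W).
rewrite !mderivD !mderivM !mderiv0 (mderiv_comm 0 1).
set a := T 'X_0; set b := T 'X_1 => e0 e1 c0 c1.
have d1 : (a^`M(0) + b^`M(1)) * f^`M(1) = 0.
  move/eqP: c0; rewrite -subr_eq0 => /eqP c0.
  by rewrite -[RHS](addr0 0) -{1}c0 -e1; ring.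
have d0 : (a^`M(0) + b^`M(1)) * f^`M(0) = 0.
  move/eqP: c1; rewrite eq_sym -subr_eq0 => /eqP c1.
  by rewrite -[RHS](addr0 0) -{1}c1 -e0; ring.
have [// | div_nz] := eqVneq (a^`M(0) + b^`M(1)) 0; case: (f_nc f@_0).
apply: (mderiv_eq0_const charK0); apply: forall_ord2; apply/eqP.
  by move/eqP: d0; rewrite mulf_eq0 (negPf div_nz).
by move/eqP: d1; rewrite mulf_eq0 (negPf div_nz).
Qed.

(** [a u, D] = a [u, D] - D(a) u, so the centralizer of D is a module over the
    kernel of D. *)
Lemma centralizer_comb (D u v : A -> A) a : W2 D -> D a = 0 ->
  centralizer D u -> centralizer D v ->
  centralizer D (fun h => a * u h + v h).
Proof.
move=> WD Da [Wu Cu] [Wv Cv]; split; first split.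
- move=> c g h; rewrite (W2_lin _ _ _ Wu) (W2_lin _ _ _ Wv).
  by rewrite -!mul_mpolyC; ring.
- by move=> g h; rewrite (proj2 Wu) (proj2 Wv); ring.
apply/funext => h; rewrite /lie_bracket (W2_add _ _ WD) (proj2 WD) Da.
transitivity (a * lie_bracket u D h + lie_bracket v D h).
  by rewrite /lie_bracket; ring.
by rewrite Cu Cv mulr0 addr0.
Qed.

Lemma centralizer_submodule (f p : A) : subalg_gen p f ->
  @is_submodule A (vfield K) (subalg_gen p) (centralizer (jacobian_der f)).
Proof.
case=> phi _ <-; have WD := jacobian_der_W2 (horner_alg p phi); split.
  split; first by split=> [c g h|g h]; rewrite ?scaler0 ?mul0r ?mulr0 addr0.
  by apply/funext => h; rewrite /lie_bracket W2_0 // subrr.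
move=> _ u v [s _ <-] Cu Cv; apply: centralizer_comb => //.
by rewrite (W2_horner_alg _ _ WD) jacobian_horner_alg jacobian_self !mulr0.
Qed.

Lemma jacobian_centralizer (p : A) phi :
  centralizer (jacobian_der (horner_alg p phi)) (jacobian_der p).
Proof.
split; first exact: jacobian_der_W2.
apply/funext => h; rewrite /lie_bracket !jacobian_horner_alg.
rewrite (proj2 (jacobian_der_W2 p)) (W2_horner_alg _ _ (jacobian_der_W2 p)).
by rewrite jacobian_self mulr0 mul0r add0r subrr.
Qed.

Section Generative.
Variables (f p : A).
Hypotheses (f_nc : forall c, f <> c%:MP) (p_gen : generative_closed f p).

Lemma generative_nonconst c : p <> c%:MP.
Proof.
move=> pc; case: p_gen => _ [phi fE]; case: (@f_nc f@_0).
apply: mderiv_eq0_const => // i.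
by rewrite fE mderiv_horner_alg pc mderivC mulr0.
Qed.

Lemma generative_deriv_neq0 phi : f = horner_alg p phi ->
  horner_alg p phi^`() != 0.
Proof.
move=> fE; apply/eqP => dphi0; case: (@f_nc f@_0).
apply: mderiv_eq0_const => // i.
by rewrite fE mderiv_horner_alg dphi0 mul0r.
Qed.

(** D_f(T(f)) = T(D_f(f)) = 0, and D_f(T(f)) is phi'(p)^2 D_p(T(p)); so T(p)
    is in ker D_p = K[p]. *)
Lemma centralizer_value (T : A -> A) : centralizer (jacobian_der f) T ->
  exists s, T p = horner_alg p s.
Proof.
move=> CT; case: (p_gen) => p_closed [phi fE].
have dphi_nz := generative_deriv_neq0 fE.
have : jacobian_der f (T f) = 0.
  by rewrite -(centralizerE f CT) jacobian_self (W2_0 (proj1 CT)).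
rewrite fE (W2_horner_alg _ _ (proj1 CT)) jacobian_horner_alg.
rewrite (proj2 (jacobian_der_W2 p)) (W2_horner_alg _ _ (jacobian_der_W2 p)).
rewrite jacobian_self mulr0 mul0r add0r => /eqP.
rewrite !mulf_eq0 (negPf dphi_nz) /= => /eqP Jp.
have [s _ <-] := jacobian_ker_closed charK0 p_closed generative_nonconst Jp.
by exists s.
Qed.

(** T is divergence-free, hence some D_k; then D_p(k) = - T(p) = 0 makes k a
    polynomial s(p), and D_k = s'(p) D_p. *)
Lemma centralizer_annihilating (T : A -> A) :
  centralizer (jacobian_der f) T -> T p = 0 ->
  exists s, forall h, T h = horner_alg p s * jacobian_der p h.
Proof.
move=> CT Tp0; case: (p_gen) => p_closed [phi fE]; have W := proj1 CT.
have Tf0 : T f = 0 by rewrite fE (W2_horner_alg _ _ W) Tp0 mulr0.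
have [k [T0 T1]] := poincare charK0 (divergence_free f_nc CT Tf0).
have TE h : T h = jacobian_der k h.
  by rewrite (W2_expand h W) T0 T1 /jacobian_der; ring.
have Jk : jacobian_der p k = 0.
  by rewrite -[RHS]oppr0 -Tp0 TE /jacobian_der; ring.
have [s _ kE] := jacobian_ker_closed charK0 p_closed generative_nonconst Jk.
by exists s^`() => h; rewrite TE -kE jacobian_horner_alg.
Qed.

Lemma jacobian_neq0 : exists i : 'I_2, jacobian_der p 'X_i != 0.
Proof.
have [J0|] := eqVneq (jacobian_der p 'X_0) 0; last by exists 0.
have [J1|] := eqVneq (jacobian_der p 'X_1) 0; last by exists 1.
case: (@generative_nonconst p@_0); apply: mderiv_eq0_const => //.
move: J0 J1; rewrite /jacobian_der !mderivXX /= !mulr0 !mulr1 sub0r subr0.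
by move=> /eqP; rewrite oppr_eq0 => /eqP d1 d0; apply: forall_ord2.
Qed.

Lemma mulr_jacobian_inj (c e : A) :
  (forall h, c * jacobian_der p h = e * jacobian_der p h) -> c = e.
Proof. by case: jacobian_neq0 => i nz /(_ 'X_i) /(mulIf nz). Qed.

Lemma centralizer_rank1 :
  (forall T, centralizer (jacobian_der f) T -> T p = 0) ->
  @free_module_of_rank A (vfield K)
    (subalg_gen p) (centralizer (jacobian_der f)) 1.
Proof.
move=> all0; have [p_closed [phi fE]] := p_gen.
split; first by apply: centralizer_submodule; exists phi.
exists (fun=> jacobian_der p); split=> [_|T CT].
  by rewrite fE; apply: jacobian_centralizer.
have [s Ts] := centralizer_annihilating CT (all0 T CT).
exists [ffun=> horner_alg p s]; split; first split.
- by move=> i; rewrite ffunE; exists s.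
- by apply/funext => h; rewrite big_ord1 ffunE Ts.
move=> c [_ TE]; apply/ffunP => i; rewrite ffunE ord1.
by apply: mulr_jacobian_inj => h; rewrite -Ts TE big_ord1.
Qed.

(** As in the proof that K[t] is principal, a T0 with T0(p) = s0(p) nonzero and
    s0 of least degree generates the image of T |-> T(p): the remainder of the
    division by s0 is again a value. The division takes place among the
    polynomials representing the values in K[p]. *)
Lemma centralizer_rank2 (T : A -> A) :
  centralizer (jacobian_der f) T -> T p != 0 ->
  @free_module_of_rank A (vfield K)
    (subalg_gen p) (centralizer (jacobian_der f)) 2.
Proof.
move=> CT Tp_nz; have [p_closed [phi fE]] := p_gen.
have Cmod : is_submodule (V := vfield K)
    (subalg_gen p) (centralizer (jacobian_der f)).
  by apply: centralizer_submodule; exists phi.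
pose P m := `[< exists T' s, [/\ centralizer (jacobian_der f) T',
   T' p = horner_alg p s, T' p != 0 & size s = m] >].
have exP : exists m, P m.
  have [s Ts] := centralizer_value CT.
  by exists (size s); apply/asboolP; exists T, s.
case: (ex_minnP exP) => m /asboolP[T0 [s0 [CT0 T0p T0p_nz s0m]]] min_m.
have s0_nz : s0 != 0.
  by apply: contraNneq T0p_nz => s00; rewrite T0p s00 rmorph0.
split=> //; exists (fun i : 'I_2 => if i == 0 then T0 else jacobian_der p).
split=> [i|T' CT'].
  by case: ifP => _ //; rewrite fE; apply: jacobian_centralizer.
have [s T's] := centralizer_value CT'.
(* T1(p) is the remainder s mod s0 evaluated at p, which must vanish. *)
pose T1 h := - horner_alg p (s %/ s0) * T0 h + T' h.
have T1E h : T1 h = T' h - horner_alg p (s %/ s0) * T0 h.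
  by rewrite /T1 addrC mulNr.
have CT1 : centralizer (jacobian_der f) T1.
  apply: (proj2 Cmod (- horner_alg p (s %/ s0)) T0 T') => //.
  by rewrite -rmorphN; exists (- (s %/ s0)).
have T1p : T1 p = horner_alg p (s %% s0).
  by rewrite T1E T's T0p {1}(divp_eq s s0) rmorphD rmorphM addrAC subrr add0r.
have T1p0 : T1 p = 0.
  have [//|T1p_nz] := eqVneq (T1 p) 0.
  suff /min_m : P (size (s %% s0)) by rewrite -s0m leqNgt ltn_modp s0_nz.
  by apply/asboolP; exists T1, (s %% s0).
have [r Tr] := centralizer_annihilating CT1 T1p0.
have T'E h :
    T' h = horner_alg p (s %/ s0) * T0 h + horner_alg p r * jacobian_der p h.
  by rewrite -Tr T1E addrC subrK.
exists [ffun i => if i == 0 then horner_alg p (s %/ s0) else horner_alg p r].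
split; first split.
- by move=> i; rewrite ffunE; case: ifP => _; [exists (s %/ s0) | exists r].
- by apply/funext => h; rewrite big_ord2 !ffunE /= T'E.
move=> c [_ T'c].
have cE h : T' h = c 0 * T0 h + c 1 * jacobian_der p h by rewrite T'c big_ord2.
have c0 : c 0 = horner_alg p (s %/ s0).
  apply: (mulIf T0p_nz); have := cE p.
  by rewrite T'E jacobian_self !mulr0 !addr0 => ->.
have c1 : c 1 = horner_alg p r.
  apply: mulr_jacobian_inj => h; have := cE h.
  by rewrite T'E c0 => /addrI ->.
by apply/ffunP; apply: forall_ord2; rewrite ffunE.
Qed.
End Generative.
End Centralizer.

Theorem theorem2 (K : closedFieldType) (charK0 : [pchar K] =i pred0)
    (f : {mpoly K[2]}) (f_nonconst : forall c : K, f <> mpolyC 2 c)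
    (p : {mpoly K[2]}) (p_gen : generative_closed f p) :
  @free_module_of_rank {mpoly K[2]} (vfield K)
      (subalg_gen p) (centralizer (jacobian_der f)) 1 \/
  @free_module_of_rank {mpoly K[2]} (vfield K)
      (subalg_gen p) (centralizer (jacobian_der f)) 2.
Proof.
have [[T CT /eqP Tp_nz]|noT] :=
  pselect (exists2 T, centralizer (jacobian_der f) T & T p <> 0).
  by right; apply: centralizer_rank2 CT Tp_nz.
left; apply: centralizer_rank1 => // T CT.
by have [//|/eqP Tp_nz] := eqVneq (T p) 0; case: noT; exists T.
Qed.
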